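(* Let $G$ be a graph. Then for every integer $k\geq 1$, we have $$\mathrm{reg}(S/J(G)^{(k)})\leq \mathrm{reg}(S/J(G)^{(k+1)}).$$
   Context: Graphs are finite and simple. Let $G$ be a graph with vertex set $V(G)=\{x_1,\ldots,x_n\}$ and edge set $E(G)$, let $\mathbb{K}$ be a field and $S=\mathbb{K}[x_1,\ldots,x_n]$ (vertices are identified with variables). The cover ideal of $G$ is $J(G)=\bigcap_{\{x_i,x_j\}\in E(G)}(x_i,x_j)\subseteq S$. For an integer $k\geq 0$, the $k$th symbolic power of an ideal $I$ of $S$ is $I^{(k)}=\bigcap_{\mathfrak{p}\in \mathrm{Min}(I)}\ker(S\to (S/I^k)_{\mathfrak{p}})$, where $\mathrm{Min}(I)$ is the set of minimal primes of $I$; for the cover ideal this gives $J(G)^{(k)}=\bigcap_{\{x_i,x_j\}\in E(G)}(x_i,x_j)^k$ (an empty intersection being $S$). For a finitely generated graded $S$-module $M$, $\beta_{i,j}(M)$ denote the graded Betti numbers, i.e. the $i$th module of the minimal graded free resolution of $M$ is $\bigoplus_j S(-j)^{\beta_{i,j}(M)}$. The Castelnuovo--Mumford regularity is $\mathrm{reg}(M)=\max\{j-i\mid \beta_{i,j}(M)\neq 0\}$. *)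

(* Defs.v *)
From mathcomp Require Export all_boot all_order all_algebra.
From mathcomp Require Export mpoly.
From mathcomp Require Export boolp classical_sets constructive_ereal.

Set Implicit Arguments.
Unset Strict Implicit.
Unset Printing Implicit Defensive.

Import Order.TTheory GRing.Theory Num.Theory.

Local Open Scope classical_set_scope.
Local Open Scope ring_scope.

(** Ideals are plain sets [I : set R]. *)

Section Ideals.
Variable R : comNzRingType.
Implicit Types (A I P : set R) (k : nat).

Definition is_ideal I : Prop :=
  I 0 /\ forall a x y, I x -> I y -> I (a * x + y).

Definition ideal_gen A : set R := smallest is_ideal A.

(* For [k = 0] the only generator is the empty product 1. *)
Definition ideal_pow I k : set R :=
  ideal_gen [set \prod_(t < k) f t | f in [set f : 'I_k -> R | forall t, I (f t)]].

Definition is_prime_ideal P : Prop :=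
  [/\ is_ideal P, ~ P 1 & forall x y, P (x * y) -> P x \/ P y].

Definition minimal_primes I : set (set R) :=
  [set P | [/\ is_prime_ideal P, I `<=` P &
    forall Q, is_prime_ideal Q -> I `<=` Q -> Q `<=` P -> Q = P]].

(* [f] is sent to 0 in the localization of R/I^k at P iff [s f] lies in I^k
   for some [s] outside of P. *)
Definition loc_kernel I k P : set R :=
  [set f | exists2 s, ~ P s & ideal_pow I k (s * f)].

Definition symbolic_pow I k : set R :=
  \bigcap_(P in minimal_primes I) loc_kernel I k P.

End Ideals.

(** A simple graph with vertices x_0, ..., x_(n-1) is given by its adjacency
    relation [e], symmetric and irreflexive. *)

Definition cover_ideal (K : fieldType) (n : nat) (e : rel 'I_n) :
    set {mpoly K[n]} :=
  \bigcap_(ij in [set ij : 'I_n * 'I_n | e ij.1 ij.2])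
    ideal_gen [set 'X_(ij.1); 'X_(ij.2)].

Arguments cover_ideal K {n} e _.

Section Regularity.
Variables (K : fieldType) (n : nat).
Local Notation S := {mpoly K[n]}.
Implicit Type I : set S.

Definition homog_of_degree (d : int) (p : S) : bool :=
  if d is Posz m then p \is m.-homog else p == 0.

(** Data of a complex ... -> F_1 -> F_0 -> S/I of graded free modules
    F_i = \bigoplus_a S(- shift i a), a < rank i. Elements of F_i are row
    vectors and maps act by right multiplication; the map F_0 -> S/I is given
    by representatives in S of the images of the basis vectors. *)
Record free_complex := FreeComplex {
  rank : nat -> nat;
  shift : forall i, 'I_(rank i) -> int;
  aug : 'cV[S]_(rank 0);
  diff : forall i, 'M[S]_(rank i.+1, rank i)
}.

(* Minimality is im (F_(i+1) -> F_i) \subseteq m F_i with m = (x_0,...,x_(n-1)):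
   the entries of the differentials have no constant term. *)
Record minimal_free_resolution I (F : free_complex) : Prop := {
  aug_homog : forall a, homog_of_degree (shift a) (aug F a 0);
  diff_homog : forall i a b,
    homog_of_degree (shift a - shift b) (diff F i a b);
  aug_surj : forall f : S, exists v : 'rV[S]_(rank F 0),
    I (f - (v *m aug F) 0 0);
  exact_aug : forall v : 'rV[S]_(rank F 0),
    I ((v *m aug F) 0 0) <-> exists w, v = w *m diff F 0;
  exact_diff : forall i (v : 'rV[S]_(rank F i.+1)),
    v *m diff F i = 0 <-> exists w, v = w *m diff F i.+1;
  diff_minimal : forall i a b, (diff F i a b)@_0%MM = 0
}.

(** The Betti number \beta_{i,j}(S/I). All minimal graded free resolutions of
    S/I are isomorphic, so the set below is a singleton for a homogeneous
    ideal I. *)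
Definition betti I (i : nat) (j : int) : nat :=
  xget 0%N [set b | exists2 F, minimal_free_resolution I F &
                    b = #|[pred a : 'I_(rank F i) | shift a == j]|].

(** reg(S/I), with the convention that it is -oo for S/I = 0. *)
Definition reg_quotient I : \bar int :=
  supremum -oo%E
    [set (ij.2 - Posz ij.1)%:E | ij in [set ij : nat * int | betti I ij.1 ij.2 != 0%N]].

End Regularity.

(* Main.v *)
From HB Require Import structures.
Require Import Defs.
From mathcomp Require Import zify.

(** The symbolic power J^(k) is spanned by the monomials x^u with
    u_i + u_j >= k on every edge ([symbolic_pow_cover]): the minimal primes of J
    are the ideals (x_i, x_j) attached to the edges, and the order of vanishing
    along x_i = x_j = 0 is a valuation.

    Let t = ceil(k / 2), and let phi raise by one every exponent which is at
    least t. A case distinction shows that u satisfies the inequalities for k if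
    and only if phi u satisfies them for k + 1. The map phi has a lower adjoint
    psi for the divisibility order, which lowers by one every exponent above t;
    in particular psi never raises the total degree. (In terms of polarizations,
    deleting the vertices of level t + 1 from the graph of J^(k+1) leaves the
    graph of J^(k).)

    Take a minimal multigraded free resolution of S/J^(k+1). In multidegree c it
    is a complex of vector spaces, spanned by the basis elements whose
    multidegree divides c, with differentials given by scalar matrices that do
    not depend on c. Replace every multidegree b by psi b and keep the scalar
    matrices. Since psi b <= c is equivalent to b <= phi c, the new complex has
    in degree c what the old one had in degree phi c; so it is exact, and it
    resolves S/J^(k) ([relabel_resolution]).

    This resolution need not be minimal, but comparison maps show that every
    shift of a minimal resolution occurs, in the same homological position, in
    any graded resolution of the same module ([shift_occurs]). Hence a nonzero
    beta_(i,j)(S/J^(k)) gives a basis element of degree b in position i of the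
    resolution of S/J^(k+1) with |psi b| = j, so |b| >= j and
    beta_(i,|b|)(S/J^(k+1)) is nonzero.

    As Betti numbers are read off an arbitrary minimal resolution, one has to be
    exhibited. Membership in J^(k+1), and then in each syzygy module, only
    depends on the truncation of the multidegree to the box [0, k + 1]^n; so
    there are finite generating systems ([generators_exist]), and taking them as
    small as possible makes the resolution minimal ([minimal_generators]). *)

Set Implicit Arguments.
Unset Strict Implicit.
Unset Printing Implicit Defensive.

Import Order.TTheory GRing.Theory Num.Theory.

Local Open Scope classical_set_scope.
Local Open Scope ring_scope.

(** * Ideals *)

Section Ideals.
Variables (R : comNzRingType) (I : set R).
Hypothesis I_ideal : is_ideal I.

Lemma idealM a f : I f -> I (a * f).
Proof. by case: I_ideal => I0 IP If; rewrite -[a * f]addr0; apply: IP. Qed.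

Lemma idealD f g : I f -> I g -> I (f + g).
Proof. by case: I_ideal => _ IP If; rewrite -[f]mul1r; apply: IP. Qed.

Lemma idealN f : I f -> I (- f).
Proof. by rewrite -mulN1r; apply: idealM. Qed.

Lemma ideal_sum (J : Type) (r : seq J) (F : J -> R) :
  (forall j, I (F j)) -> I (\sum_(j <- r) F j).
Proof.
by move=> IF; elim/big_ind: _ => // [|f g]; [apply: I_ideal.1 | apply: idealD].
Qed.

End Ideals.

Lemma ideal_gen_ideal (R : comNzRingType) (A : set R) : is_ideal (ideal_gen A).
Proof.
split=> [J [[]//]|a x y Ix Iy J [JI AJ]].
by apply: JI.2; [apply: Ix | apply: Iy].
Qed.

(** * Parts of a polynomial *)

Section Parts.
Variables (K : fieldType) (n : nat).
Local Notation S := {mpoly K[n]}.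
Implicit Types (p q f : S) (u m : 'X_{1..n}) (d : int).

Definition mpart (P : pred 'X_{1..n}) p : S :=
  \sum_(m <- msupp p | P m) p@_m *: 'X_[m].

Lemma mcoeff_mpart P p u : (mpart P p)@_u = if P u then p@_u else 0.
Proof.
rewrite /mpart raddf_sum /=.
under eq_bigr do rewrite mcoeffZ mcoeffX.
case: (boolP (u \in msupp p)) => [up|/[dup] up /memN_msupp_eq0 pu0]; last first.
  rewrite pu0 if_same big_seq_cond big1 // => m /andP[mp _].
  by case: eqP up => [<-|]; rewrite ?mp // mulr0.
rewrite big_mkcond (bigD1_seq u) ?msupp_uniq //= eqxx mulr1.
rewrite big1 ?addr0 // => m /negPf->.
by rewrite mulr0 if_same.
Qed.

Lemma mcoeffMX_sub p m u :
  (p * 'X_[m])@_u = if (m <= u)%MM then p@_(u - m) else 0.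
Proof.
case: ifP => [mu|mu]; first by rewrite -{1}(submK mu) addmC mcoeffMX.
apply: memN_msupp_eq0; apply: contraFN mu.
by rewrite (perm_mem (msuppMX _ _)) => /mapP[w _ ->]; apply: lem_addr.
Qed.

Definition hpart d : S -> S := mpart (fun m => (mdeg m)%:Z == d).

Lemma homog_of_degreeP d p :
  reflect (forall m, p@_m != 0 -> (mdeg m)%:Z = d) (homog_of_degree d p).
Proof.
case: d => d /=.
  apply: (iffP (dhomogP _ _ _)) => H m; first by rewrite -mcoeff_msupp => /H ->.
  by rewrite mcoeff_msupp => /H [].
apply: (iffP eqP) => [->|H]; first by move=> m; rewrite mcoeff0 eqxx.
by apply/mpolyP => m; rewrite mcoeff0; apply/eqP; apply/negP => /negP /H.
Qed.

Lemma homog_hpart d p : homog_of_degree d (hpart d p).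
Proof.
apply/homog_of_degreeP => m; rewrite mcoeff_mpart.
by case: ifP => [/eqP//|]; rewrite eqxx.
Qed.

Lemma hpart_id d p : homog_of_degree d p -> hpart d p = p.
Proof.
move=> /homog_of_degreeP H; apply/mpolyP => m; rewrite mcoeff_mpart; case: eqP => //.
by move=> nd; apply/esym/eqP/negP => /negP /H.
Qed.

Lemma hpart_is_zmod_morphism d : zmod_morphism (hpart d).
Proof.
move=> p q; apply/mpolyP => m; rewrite mcoeffB !mcoeff_mpart mcoeffB.
by case: ifP; rewrite ?subr0.
Qed.

HB.instance Definition _ d :=
  GRing.isZmodMorphism.Build S S (hpart d) (hpart_is_zmod_morphism d).

Lemma hpartM d e p q : homog_of_degree e q ->
  hpart d (p * q) = hpart (d - e) p * q.
Proof.
move=> /homog_of_degreeP hq; apply/mpolyP => m.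
rewrite mcoeff_mpart !mcoeffM.
transitivity (\sum_(k : 'X_{1..n < (mdeg m).+1, (mdeg m).+1}
    | m == (k.1 + k.2)%MM)
  (if (mdeg m)%:Z == d then p@_k.1 * q@_k.2 else 0)).
  by case: ifP => //; rewrite big1.
apply: eq_bigr => -[k1 k2] /= /eqP mE; rewrite mcoeff_mpart.
case: (eqVneq (q@_k2) 0) => [->|/hq k2e]; first by rewrite !mulr0 if_same.
rewrite [X in Posz X](congr1 (@mdeg n) mE) mdegD PoszD k2e -subr_eq opprK.
by case: ifP; rewrite ?mul0r.
Qed.

Lemma homogM d e p q : homog_of_degree d p -> homog_of_degree e q ->
  homog_of_degree (d + e) (p * q).
Proof.
move=> hp hq; rewrite -(hpart_id hp).
by rewrite -[in X in hpart X](addrK e d) -hpartM // homog_hpart.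
Qed.

Lemma homog_sum d (J : Type) (r : seq J) (F : J -> S) :
  (forall j, homog_of_degree d (F j)) -> homog_of_degree d (\sum_(j <- r) F j).
Proof.
move=> hF; rewrite -(eq_bigr _ (fun j _ => hpart_id (hF j))).
by rewrite -raddf_sum homog_hpart.
Qed.

End Parts.

(** * Comparison of resolutions *)

Section Comparison.
Variables (K : fieldType) (n : nat).
Local Notation S := {mpoly K[n]}.
Implicit Types (F G : free_complex K n).

Section Degrees.
Implicit Types (p q r : nat).

Definition mhomog p q (s : 'I_p -> int) (t : 'I_q -> int) (A : 'M[S]_(p, q)) :=
  forall a b, homog_of_degree (s a - t b) (A a b).

Lemma mhomogM p q r (s : 'I_p -> int) (t : 'I_q -> int) (u : 'I_r -> int) A B :
  mhomog s t A -> mhomog t u B -> mhomog s u (A *m B).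
Proof.
move=> hA hB a b; rewrite mxE; apply: homog_sum => j.
by rewrite -[s a](subrK (t j)) -addrA; apply: homogM; [exact: hA | exact: hB].
Qed.

(** Rows are elements of the free module whose b-th basis vector has degree
    [t b]; of the a-th one, only the homogeneous part of degree [s a] is kept. *)
Definition rowparts p q (s : 'I_p -> int) (t : 'I_q -> int)
    (A : 'M[S]_(p, q)) : 'M[S]_(p, q) :=
  \matrix_(a, b) hpart (s a - t b) (A a b).

Lemma mhomog_rowparts p q (s : 'I_p -> int) (t : 'I_q -> int) A :
  mhomog s t (rowparts s t A).
Proof. by move=> a b; rewrite mxE homog_hpart. Qed.

Lemma rowparts_id p q (s : 'I_p -> int) (t : 'I_q -> int) A :
  mhomog s t A -> rowparts s t A = A.
Proof. by move=> hA; apply/matrixP => a b; rewrite mxE hpart_id. Qed.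

Lemma rowpartsM p q r (s : 'I_p -> int) (t : 'I_q -> int) (u : 'I_r -> int)
    A B :
  mhomog t u B -> rowparts s u (A *m B) = rowparts s t A *m B.
Proof.
move=> hB; apply/matrixP => a b; rewrite !mxE raddf_sum; apply: eq_bigr => j _.
rewrite mxE /= (hpartM _ _ (hB j b)); congr (hpart _ _ * _).
by rewrite opprB addrA subrK.
Qed.

End Degrees.

Variable I : set S.
Hypothesis I_ideal : is_ideal I.
Hypothesis I_hpart : forall d f, I f -> I (hpart d f).

(** Kernels of the augmentation F_0 -> S/I and of the differentials, so that
    exactness takes the same form in all positions. *)
Definition cycle F i : 'rV[S]_(rank F i) -> Prop :=
  match i with
  | 0 => fun v => I ((v *m aug F) 0 0)
  | i.+1 => fun v => v *m diff F i = 0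
  end.

(** A free resolution which need not be minimal. *)
Record graded_resolution F : Prop := GradedResolution {
  gr_aug : mhomog (@shift _ _ F 0) (fun=> 0) (aug F);
  gr_diff : forall i, mhomog (@shift _ _ F i.+1) (@shift _ _ F i) (diff F i);
  gr_surj : forall f : S, exists v : 'rV_(rank F 0), I (f - (v *m aug F) 0 0);
  gr_exact : forall i (v : 'rV_(rank F i)),
    cycle v <-> exists w, v = w *m diff F i
}.

Arguments gr_diff {F} _ i.
Arguments gr_exact {F} _ {i} v.

Lemma minimal_graded F : minimal_free_resolution I F -> graded_resolution F.
Proof.
case=> h1 h2 h3 h4 h5 _; split => //.
  by move=> a b; rewrite ord1 subr0; apply: h1.
by case=> [|i] v; [apply: h4 | apply: h5].
Qed.

Definition cyclic_rows F i q (A : 'M[S]_(q, rank F i)) : Prop :=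
  forall v, cycle (v *m A).

Lemma cyclic_rows0P F q (A : 'M[S]_(q, rank F 0)) :
  (forall a, I ((A *m aug F) a 0)) -> @cyclic_rows F 0 q A.
Proof.
move=> IA v /=; rewrite -mulmxA mxE.
by apply: (ideal_sum I_ideal) => j; apply: idealM.
Qed.

Lemma cyclic_rowsSP F i q (A : 'M[S]_(q, rank F i.+1)) :
  A *m diff F i = 0 -> @cyclic_rows F i.+1 q A.
Proof. by move=> A0 v /=; rewrite -mulmxA A0 mulmx0. Qed.

Lemma lift_cyclic G i q (A : 'M[S]_(q, rank G i)) : graded_resolution G ->
  cyclic_rows A -> exists B, A = B *m diff G i.
Proof.
move=> rG cA.
have /boolp.choice[h hE] : forall a, exists w : 'rV_(rank G i.+1),
    row a A = w *m diff G i.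
  by move=> a; rewrite rowE; apply/(gr_exact rG)/cA.
exists (\matrix_a h a); apply/row_matrixP => a.
by rewrite row_mul rowK.
Qed.

Lemma lift_cyclic_homog G i q (s : 'I_q -> int) (A : 'M[S]_(q, rank G i)) :
  graded_resolution G -> mhomog s (@shift _ _ G i) A ->
  cyclic_rows A ->
  exists2 B, A = B *m diff G i & mhomog s (@shift _ _ G i.+1) B.
Proof.
move=> rG hA /(lift_cyclic rG)[B AE].
exists (rowparts s (@shift _ _ G i.+1) B); last exact: mhomog_rowparts.
by rewrite -(rowpartsM _ _ (gr_diff rG i)) -AE rowparts_id.
Qed.

Definition cycle_map F G i (A : 'M[S]_(rank F i, rank G i)) : Prop :=
  forall v : 'rV_(rank F i), cycle v -> cycle (v *m A).

Lemma cyclic_diff G i : graded_resolution G -> cyclic_rows (diff G i).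
Proof. by move=> rG v; apply/(gr_exact rG); exists v. Qed.

Lemma diff_diff G i : graded_resolution G -> diff G i.+1 *m diff G i = 0.
Proof.
move=> rG; apply/row_matrixP => a; rewrite row_mul row0 rowE.
exact: (@cyclic_diff G i.+1 rG).
Qed.

(** The image of a basis vector of F_0 in S/I comes from an element of G_0,
    because G_0 maps onto S/I. Its part of the right degree has the same image
    since I is homogeneous. *)
Lemma comparison0 F G : graded_resolution F -> graded_resolution G ->
  exists2 A : 'M[S]_(rank F 0, rank G 0),
    mhomog (@shift _ _ F 0) (@shift _ _ G 0) A &
    forall a, I ((aug F - A *m aug G) a 0).
Proof.
move=> rF rG.
have /boolp.choice[h hE] : forall a, exists w : 'rV_(rank G 0),
    I (aug F a 0 - (w *m aug G) 0 0).
  by move=> a; apply: gr_surj.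
set s := @shift _ _ F 0; set t := @shift _ _ G 0.
exists (rowparts s t (\matrix_a h a)); first exact: mhomog_rowparts.
move=> a; rewrite -(rowpartsM _ _ (gr_aug rG)).
have -> : (aug F - rowparts s (fun=> 0) (\matrix_a h a *m aug G)) a 0 =
    hpart (s a) (aug F a 0 - (h a *m aug G) 0 0).
  rewrite [RHS]raddfB /= hpart_id; last by move: (gr_aug rF a 0); rewrite subr0.
  rewrite !mxE subr0; congr (_ - hpart _ _).
  by apply: eq_bigr => j _; rewrite !mxE.
exact: I_hpart.
Qed.

Lemma comparison0_cycle F G (A : 'M[S]_(rank F 0, rank G 0)) :
  (forall a, I ((aug F - A *m aug G) a 0)) -> @cycle_map F G 0 A.
Proof.
move=> IA v /= Iv; rewrite -mulmxA.
have -> : A *m aug G = aug F - (aug F - A *m aug G) by rewrite subKr.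
rewrite mulmxBr mxE; apply: (idealD I_ideal) => //.
rewrite mxE; apply: (idealN I_ideal); rewrite mxE.
by apply: (ideal_sum I_ideal) => j; apply: idealM.
Qed.

Lemma comparisonS F G i (A : 'M[S]_(rank F i, rank G i)) :
  graded_resolution F -> graded_resolution G ->
  mhomog (@shift _ _ F i) (@shift _ _ G i) A -> cycle_map A ->
  exists B : 'M[S]_(rank F i.+1, rank G i.+1),
    [/\ mhomog (@shift _ _ F i.+1) (@shift _ _ G i.+1) B,
        @cycle_map F G i.+1 B & diff F i *m A = B *m diff G i].
Proof.
move=> rF rG hA cA.
have [] := @lift_cyclic_homog G i _ (@shift _ _ F i.+1) (diff F i *m A) rG.
- exact: mhomogM (gr_diff rF i) hA.
- by move=> v; rewrite mulmxA; apply/cA/cyclic_diff.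
move=> B BE hB; exists B; split => // v /= v0.
by rewrite -mulmxA -BE mulmxA v0 mul0mx.
Qed.

(** Reduction modulo the variables. *)
Definition const0 p q (A : 'M[S]_(p, q)) : 'M[K]_(p, q) :=
  map_mx (mcoeff 0%MM) A.

(** The composite of the comparison maps F -> G -> F differs from the identity
    by H_i d_i + d_(i-1) H_(i-1), for a homotopy H. The matrix [R] is the summand
    d_(i-1) H_(i-1); it vanishes modulo the variables because F is minimal, and
    knowing that d_i R = 0 is all that is needed to build the next homotopy. *)
Lemma comparison_unit F G i :
  minimal_free_resolution I F -> graded_resolution G ->
  exists (A : 'M[S]_(rank F i, rank G i)) (B : 'M[S]_(rank G i, rank F i))
         (H : 'M[S]_(rank F i, rank F i.+1)),
  let R := A *m B - 1%:M - H *m diff F i in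
    [/\ mhomog (@shift _ _ F i) (@shift _ _ G i) A,
        mhomog (@shift _ _ G i) (@shift _ _ F i) B,
        cycle_map A, cycle_map B & diff F i *m R = 0 /\ const0 R = 0].
Proof.
move=> mF rG; have rF := minimal_graded mF.
elim: i => [|i [A [B [H /= [hA hB cA cB [dR R0]]]]]].
  have [A hA IA] := comparison0 rF rG.
  have [B hB IB] := comparison0 rG rF.
  have /(lift_cyclic rF)[H HE] : @cyclic_rows F 0 _ (A *m B - 1%:M).
    apply: cyclic_rows0P => a.
    have -> : (A *m B - 1%:M) *m aug F =
        - (A *m (aug G - B *m aug F)) - (aug F - A *m aug G).
      by rewrite mulmxBl mul1mx mulmxBr mulmxA !opprB addrA subrK.
    rewrite mxE; apply: (idealD I_ideal); rewrite mxE; apply: idealN => //.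
    by rewrite mxE; apply: (ideal_sum I_ideal) => j; apply: idealM.
  exists A, B, H => /=; rewrite -HE subrr mulmx0; split=> //.
  - exact: comparison0_cycle.
  - exact: comparison0_cycle.
  - by split=> //; apply/matrixP => a b; rewrite !mxE mcoeff0.
have [A' [hA' cA' AE]] := comparisonS rF rG hA cA.
have [B' [hB' cB' BE]] := comparisonS rG rF hB cB.
have /(lift_cyclic rF)[H' HE] :
    @cyclic_rows F i.+1 _ (A' *m B' - 1%:M - diff F i *m H).
  apply: cyclic_rowsSP; rewrite -[RHS]dR.
  rewrite !mulmxBr !mulmxBl mul1mx mulmx1 -!mulmxA -BE.
  by rewrite (mulmxA A') -AE !mulmxA.
exists A', B', H' => /=; split=> //.
(* The new R is d_i H_i. *)
rewrite -HE opprB addrC subrK; split.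
  by rewrite mulmxA diff_diff // mul0mx.
apply/matrixP => a b; rewrite !mxE raddf_sum big1 // => j _.
by rewrite /= rmorphM /= (diff_minimal mF) mul0r.
Qed.

(** Modulo the variables the composite F -> G -> F is the identity, so some
    product of constant terms in its a-th diagonal entry is nonzero; an entry of
    a homogeneous matrix has a constant term only between equal degrees. *)
Theorem shift_occurs F G i (a : 'I_(rank F i)) :
  minimal_free_resolution I F -> graded_resolution G ->
  exists b : 'I_(rank G i), shift b = shift a.
Proof.
move=> mF rG.
have [A [B [H /= [hA _ _ _ [_ R0]]]]] := comparison_unit i mF rG.
have : const0 (A *m B) a a = 1.
  move/matrixP/(_ a a): R0.
  rewrite !mxE eqxx 2!raddfB /= mcoeff1 eqxx [X in _ - X]raddf_sum.
  rewrite [X in _ - X]big1 => [|j _]; last first.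
    by rewrite /= rmorphM /= (diff_minimal mF) mulr0.
  by move=> /eqP; rewrite subr0 subr_eq0 => /eqP.
rewrite !mxE raddf_sum /=.
have [/existsP[b Ab0] _|/existsPn A0] := boolP [exists b, (A a b)@_0 != 0].
  exists b; move/homog_of_degreeP/(_ _ Ab0): (hA a b).
  by rewrite mdeg0 => /esym/eqP; rewrite subr_eq0 => /eqP.
rewrite big1 => [/esym/eqP|b _]; first by rewrite oner_eq0.
by rewrite /= rmorphM /=; move/negPn/eqP: (A0 b) => ->; rewrite mul0r.
Qed.

End Comparison.

(** * Multigraded complexes and their strands *)

Section Strands.
Variables (K : fieldType) (n : nat).
Local Notation X := 'X_{1..n}.
Implicit Types (c u : X) (r : nat).

(** In multidegree c, the free module with basis degrees [m] is spanned over K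
    by the basis elements of degree at most c, each times a monomial. This space
    is encoded as a coordinate subspace of K^r, the row space of a diagonal
    matrix. *)
Definition strand r (m : 'I_r -> X) c : 'M[K]_r :=
  diag_mx (\row_a (m a <= c)%MM%:R).

Lemma strandP r (m : 'I_r -> X) c (v : 'rV[K]_r) :
  reflect (forall a, v 0 a != 0 -> (m a <= c)%MM) (v <= strand m c)%MS.
Proof.
apply: (iffP idP) => [/submxP[w ->] a|H].
  rewrite mul_mx_diag !mxE; case: (m a <= c)%MM => //.
  by rewrite mulr0 eqxx.
suff -> : v = v *m strand m c by apply: submxMl.
apply/rowP => a; rewrite mul_mx_diag !mxE.
have [->|/H ->] := eqVneq (v 0 a) 0; first by rewrite mul0r.
by rewrite mulr1.
Qed.

Lemma strandS r (m : 'I_r -> X) c c' : (c <= c')%MM ->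
  (strand m c <= strand m c')%MS.
Proof.
move=> cc'; apply/rV_subP => v /strandP H; apply/strandP => a /H mc.
exact: lepm_trans mc cc'.
Qed.

Lemma eq_strand r (m m' : 'I_r -> X) c c' :
  (forall a, (m a <= c)%MM = (m' a <= c')%MM) -> strand m c = strand m' c'.
Proof. by move=> H; congr diag_mx; apply/rowP => a; rewrite !mxE H. Qed.

Variable D : nat.

Definition trunc c : X := [multinom minn (c i) D | i < n].

Definition in_box c : Prop := forall i, (c i <= D)%N.

Lemma trunc_in_box c : in_box (trunc c).
Proof. by move=> i; rewrite mnmE geq_minr. Qed.

Lemma trunc_le c : (trunc c <= c)%MM.
Proof. by apply/mnm_lepP => i; rewrite mnmE geq_minl. Qed.

Lemma le_trunc u c : in_box u -> (u <= trunc c)%MM = (u <= c)%MM.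
Proof.
move=> uD; apply/mnm_lepP/mnm_lepP => H i; move: (H i); rewrite mnmE leq_min.
  by case/andP.
by rewrite uD andbT.
Qed.

(** The homogeneous components of a multigraded submodule of a free module, seen
    inside K^r; multiplication by monomials becomes inclusion. The second
    condition makes the components in the box [0, D]^n determine the others. *)
Record box_filtration r (N : X -> 'M[K]_r) : Prop := BoxFiltration {
  filt_mono : forall c c', (c <= c')%MM -> (N c <= N c')%MS;
  filt_trunc : forall c, (N c <= N (trunc c))%MS
}.

Record generates r (N : X -> 'M[K]_r) r' (m : 'I_r' -> X) (g : 'M[K]_(r', r))
    : Prop := Generates {
  gen_box : forall a, in_box (m a);
  gen_mem : forall a, (row a g <= N (m a))%MS;
  gen_span : forall c (v : 'rV_r), (v <= N c)%MS ->
    exists2 w, (w <= strand m c)%MS & v = w *m g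
}.

(** Rows spanning the components in the finite box generate everything. *)
Lemma generators_exist r (N : X -> 'M[K]_r) : box_filtration N ->
  exists r' (m : 'I_r' -> X) (g : 'M_(r', r)), generates N m g.
Proof.
move=> fN; pose T : finType := ({ffun 'I_n -> 'I_D.+1} * 'I_r)%type.
pose mon (f : {ffun 'I_n -> 'I_D.+1}) : X := [multinom f i : nat | i < n].
pose m (a : 'I_#|T|) := mon (enum_val a).1.
pose g : 'M[K]_(#|T|, r) :=
  \matrix_a row (enum_val a).2 (N (m a)).
exists #|T|, m, g; split.
- by move=> a i; rewrite mnmE -ltnS.
- by move=> a; rewrite rowK row_sub.
move=> c v /submx_trans/(_ (filt_trunc fN c))/submxP[w ->].
pose f : {ffun 'I_n -> 'I_D.+1} := [ffun i => inord (trunc c i)].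
have fE : mon f = trunc c.
  by apply/mnmP => i; rewrite mnmE ffunE inordK // ltnS trunc_in_box.
exists (\row_a if (enum_val a).1 == f then w 0 (enum_val a).2 else 0).
  apply/strandP => a; rewrite mxE /m.
  case: ifP => [/eqP-> _|]; last by rewrite eqxx.
  by rewrite fE trunc_le.
rewrite [RHS]mulmx_sum_row.
rewrite (reindex (@enum_rank T)) /=; last by apply/onW_bij/enum_rank_bij.
under eq_bigr do rewrite mxE rowK /m enum_rankK.
rewrite -(pair_bigA _ (fun p j =>
  (if p == f then w 0 j else 0) *: row j (N (mon p)))) /=.
rewrite (bigD1 f) //= eqxx fE mulmx_sum_row.
rewrite [X in _ = _ + X]big1 ?addr0 // => p /negPf pf.
by rewrite big1 // => j _; rewrite pf scale0r.
Qed.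

Lemma mulmx_drop r' r (b : 'I_r'.+1) (w : 'rV[K]_r'.+1) (g : 'M[K]_(r'.+1, r)) :
  w 0 b = 0 -> w *m g = col' b w *m row' b g.
Proof.
move=> wb; apply/rowP => j; rewrite !mxE (bigD1_ord b) //= wb mul0r add0r.
by apply: eq_bigr => i _; rewrite !mxE.
Qed.

(** A generating system of the least size is minimal in the graded sense: a
    relation in which a generator of the same degree occurs with a nonzero
    coefficient would make that generator redundant. *)
Lemma minimal_generators r (N : X -> 'M[K]_r) : box_filtration N ->
  exists r' (m : 'I_r' -> X) (g : 'M_(r', r)), generates N m g /\
    forall (z : 'rV_r') b, (z <= strand m (m b))%MS -> z *m g = 0 -> z 0 b = 0.
Proof.
move=> fN.
pose P r' := `[< exists (m : 'I_r' -> X) (g : 'M_(r', r)), generates N m g >].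
have exP : exists r', P r'.
  by have [r' H] := generators_exist fN; exists r'; apply/boolp.asboolP.
case: (ex_minnP exP) => r' /boolp.asboolP[m [g gN]] minr'.
exists r', m, g; split=> // z b zb zg; apply/eqP/negP => /negP zb0.
case: r' => [|r'] in m g gN minr' z b zb zg zb0 *; first by case: b zb zb0.
suff /minr' : P r' by rewrite ltnn.
apply/boolp.asboolP; exists (m \o lift b), (row' b g).
split=> [a|a|c v /(gen_span gN)[w wc vE]]; first exact: gen_box gN _.
  have -> : row a (row' b g) = row (lift b a) g by apply/rowP=> j; rewrite !mxE.
  exact: gen_mem gN _.
(* The relation z eliminates the b-th generator from w. *)
pose w' := w - (w 0 b / z 0 b) *: z.
have w'c : (w' <= strand m c)%MS.
  apply: addmx_sub => //; rewrite -scaleNr.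
  have [->|wb0] := eqVneq (w 0 b) 0.
    by rewrite mul0r oppr0 scale0r sub0mx.
  apply: scalemx_sub; apply: submx_trans zb (strandS _ _).
  exact/(strandP _ _ _ wc).
have w'b : w' 0 b = 0 by rewrite !mxE divfK // subrr.
exists (col' b w').
  by apply/strandP => a; rewrite mxE => /(strandP _ _ _ w'c).
by rewrite -mulmx_drop // mulmxBl -scalemxAl zg scaler0 subr0.
Qed.

(** * Minimal multigraded resolutions of monomial ideals *)

(** Augmentation and differentials are recorded by their scalar coefficients:
    the entry between basis elements of degrees b and b' is a scalar times
    x^(b - b'). *)
Record multicomplex := MultiComplex {
  mrank : nat -> nat;
  mshift : forall i, 'I_(mrank i) -> X;
  maug : 'cV[K]_(mrank 0);
  mdiff : forall i, 'M[K]_(mrank i.+1, mrank i)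
}.

(** Exactness of the augmented complex of vector spaces in every multidegree,
    for the quotient of S by the monomial ideal with exponents in [A]: that
    quotient is 0 in degree c if [A c] holds, and K otherwise. *)
Record multiresolution (A : pred X) (C : multicomplex) : Prop := {
  mres_diff : forall i a b, mdiff C i a b != 0 -> (mshift b <= mshift a)%MM;
  mres_surj : forall c, ~~ A c -> exists2 v : 'rV_(mrank C 0),
    (v <= strand (@mshift C 0) c)%MS & v *m maug C = 1%:M;
  mres_exact_aug : forall c (v : 'rV_(mrank C 0)),
    (v <= strand (@mshift C 0) c)%MS ->
    (~~ A c -> v *m maug C = 0) <->
    exists2 w, (w <= strand (@mshift C 1) c)%MS & v = w *m mdiff C 0;
  mres_exact : forall i c (v : 'rV_(mrank C i.+1)),
    (v <= strand (@mshift C i.+1) c)%MS ->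
    v *m mdiff C i = 0 <->
    exists2 w, (w <= strand (@mshift C i.+2) c)%MS & v = w *m mdiff C i.+1
}.

Definition multiminimal (C : multicomplex) : Prop :=
  forall i (a : 'I_(mrank C i.+1)) (b : 'I_(mrank C i)),
    mshift a = mshift b -> mdiff C i a b = 0.

(** A free module of the resolution, together with the submodule that the next
    differential has to generate. *)
Record stage := Stage {
  srank : nat;
  sshift : 'I_srank -> X;
  sker : X -> 'M[K]_srank;
  sker_filt : box_filtration sker;
  sker_strand : forall c, (sker c <= strand sshift c)%MS
}.

Lemma stage_generators (s : stage) :
  exists x : {r' : nat & ('I_r' -> X) * 'M[K]_(r', srank s)}%type,
    let m := (projT2 x).1 in let g := (projT2 x).2 in
    generates (@sker s) m g /\
    forall (z : 'rV_(projT1 x)) b,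
      (z <= strand m (m b))%MS -> z *m g = 0 -> z 0 b = 0.
Proof.
have [r' [m [g H]]] := minimal_generators (sker_filt s).
by exists (existT _ r' (m, g)).
Qed.

Definition gens s := sval (boolp.cid (stage_generators s)).
Definition gens_rank s := projT1 (gens s).
Definition gens_shift s : 'I_(gens_rank s) -> X := (projT2 (gens s)).1.
Definition gens_mx s : 'M[K]_(gens_rank s, srank s) := (projT2 (gens s)).2.

Lemma gensP s : generates (@sker s) (@gens_shift s) (@gens_mx s).
Proof. exact: (svalP (boolp.cid (stage_generators s))).1. Qed.

Lemma gens_min s (z : 'rV_(gens_rank s)) b :
  (z <= strand (@gens_shift s) (gens_shift b))%MS ->
  z *m gens_mx s = 0 -> z 0 b = 0.
Proof. exact: (svalP (boolp.cid (stage_generators s))).2. Qed.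

Definition syz s c : 'M[K]_(gens_rank s) :=
  (strand (@gens_shift s) c :&: kermx (gens_mx s))%MS.

(** All generators have degree in the box, so the strand in degree c, and with it
    the syzygies, only depend on [trunc c]: the box never has to grow. *)
Lemma syz_filt s : box_filtration (@syz s).
Proof.
split=> [c c' cc'|c]; first by rewrite capmxS // strandS.
rewrite /syz (@eq_strand _ _ (@gens_shift s) c (trunc c)) // => a.
by rewrite le_trunc //; apply: gen_box (gensP s) _.
Qed.

Lemma syz_strand s c : (@syz s c <= strand (@gens_shift s) c)%MS.
Proof. exact: capmxSl. Qed.

Definition next_stage s : stage := Stage (@syz_filt s) (@syz_strand s).

Variable A : pred X.
Hypothesis A_up : forall c c', (c <= c')%MM -> A c -> A c'.
Hypothesis A_trunc : forall c, A c -> A (trunc c).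

Definition ideal_filtration c : 'M[K]_1 := if A c then 1%:M else 0.

Lemma ideal_filtrationP : box_filtration ideal_filtration.
Proof.
rewrite /ideal_filtration; split=> [c c' cc'|c].
  case: ifP => [Ac|_]; last exact: sub0mx.
  by rewrite (A_up cc' Ac).
by case: ifP => [/A_trunc ->|_] //; exact: sub0mx.
Qed.

Lemma ideal_filtration_strand c :
  (ideal_filtration c <= strand (fun=> 0%MM) c)%MS.
Proof.
apply/rV_subP => v _; apply/strandP => a _.
by apply/mnm_lepP => i; rewrite mnm0E.
Qed.

Definition first_stage := Stage ideal_filtrationP ideal_filtration_strand.

Definition stages i := iter i next_stage first_stage.

Definition min_complex : multicomplex :=
  @MultiComplex (fun i => srank (stages i)) (fun i => @sshift (stages i))
    1%:M (fun i => gens_mx (stages i)).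

Lemma min_complex_sker i c (v : 'rV_(srank (stages i))) :
  (v <= sker (stages i) c)%MS <->
  exists2 w, (w <= strand (@mshift min_complex i.+1) c)%MS &
             v = w *m mdiff min_complex i.
Proof.
split; first exact: gen_span (gensP (stages i)) _ _.
case=> w /strandP wc ->; rewrite mulmx_sum_row summx_sub // => a _.
have [->|/wc ac] := eqVneq (w 0 a) 0; first by rewrite scale0r sub0mx.
apply: scalemx_sub; apply: submx_trans (gen_mem (gensP (stages i)) a) _.
exact: filt_mono (sker_filt _) _ _ ac.
Qed.

Lemma min_complex_resolution : multiresolution A min_complex.
Proof.
split.
- move=> i a b ab0.
  have := submx_trans (gen_mem (gensP (stages i)) a) (@sker_strand _ _).
  by move/strandP; apply; rewrite mxE.
- move=> c _; exists 1%:M; last by rewrite mulmx1.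
  by apply/strandP => a _; apply/mnm_lepP => i; rewrite mnm0E.
- move=> c v _; rewrite -min_complex_sker /= mulmx1 /ideal_filtration.
  case: (A c); first by rewrite submx1.
  by rewrite submx0; split=> [->|/eqP->] //.
- move=> i c v vc; rewrite -min_complex_sker /= /syz.
  rewrite sub_capmx vc /=.
  by split=> /sub_kermxP.
Qed.

Lemma min_complex_minimal : ~~ A 0%MM -> multiminimal min_complex.
Proof.
move=> A0 [|i] a b ab.
  have := gen_mem (gensP (stages 0)) a.
  rewrite [X in sker _ X](ab : gens_shift a = 0%MM) /= /ideal_filtration.
  by rewrite (negPf A0) submx0 => /eqP/rowP/(_ b); rewrite !mxE.
have := gen_mem (gensP (stages i.+1)) a.
rewrite [X in sker _ X](ab : gens_shift a = gens_shift b).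
rewrite sub_capmx => /andP[ha /sub_kermxP g0].
by have := gens_min ha g0; rewrite mxE.
Qed.

End Strands.

(** * From strands to polynomial matrices *)

Lemma choice2 T U (P Q : T -> U -> Prop) :
  (forall x, exists2 y, P x y & Q x y) ->
  exists2 f, (forall x, P x (f x)) & (forall x, Q x (f x)).
Proof.
move=> H; have /boolp.choice[f fP] : forall x, exists y, P x y /\ Q x y.
  by move=> x; have [y Py Qy] := H x; exists y.
by exists f => x; have [] := fP x.
Qed.

Section Realization.
Variables (K : fieldType) (n : nat).
Local Notation S := {mpoly K[n]}.
Local Notation X := 'X_{1..n}.
Implicit Types (c u : X) (r : nat).

Definition homogenize r' r (m' : 'I_r' -> X) (m : 'I_r -> X)
    (L : 'M[K]_(r', r)) : 'M[S]_(r', r) :=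
  \matrix_(a, b) (L a b *: 'X_[m' a - m b]).

Definition degree_compatible r' r (m' : 'I_r' -> X) (m : 'I_r -> X)
    (L : 'M[K]_(r', r)) : Prop :=
  forall a b, L a b != 0 -> (m b <= m' a)%MM.

Lemma mhomog_homogenize r' r (m' : 'I_r' -> X) (m : 'I_r -> X) L :
  degree_compatible m' m L ->
  mhomog (fun a => (mdeg (m' a))%:Z) (fun b => (mdeg (m b))%:Z)
    (homogenize m' m L).
Proof.
move=> compL a b; apply/homog_of_degreeP => u; rewrite mxE mcoeffZ mcoeffX.
case: (_ =P u) => [<-|]; last by rewrite mulr0 eqxx.
rewrite mulr1 => /compL ba.
by rewrite -[in RHS](submK ba) mdegD PoszD addrK.
Qed.

(** The component of multidegree c of an element of the free module with basis
    degrees [m]: the coordinate a is the coefficient of x^(c - m a). *)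
Definition comp r (m : 'I_r -> X) c (v : 'rV[S]_r) : 'rV[K]_r :=
  \row_a if (m a <= c)%MM then (v 0 a)@_(c - m a) else 0.

Lemma comp_strand r (m : 'I_r -> X) c v : (comp m c v <= strand K m c)%MS.
Proof. by apply/strandP => a; rewrite mxE; case: ifP => //; rewrite eqxx. Qed.

Lemma comp_is_zmod_morphism r (m : 'I_r -> X) c : zmod_morphism (comp m c).
Proof.
move=> v w; apply/rowP => a; rewrite !mxE mcoeffB.
by case: ifP; rewrite ?subr0.
Qed.

HB.instance Definition _ r (m : 'I_r -> X) c :=
  GRing.isZmodMorphism.Build 'rV[S]_r 'rV[K]_r (comp m c)
    (comp_is_zmod_morphism m c).

Lemma comp_inj r (m : 'I_r -> X) v w :
  (forall c, comp m c v = comp m c w) -> v = w.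
Proof.
move=> H; apply/rowP => a; apply/mpolyP => u.
by move/rowP/(_ a): (H (u + m a)%MM); rewrite !mxE lem_addl addmK.
Qed.

(** In each multidegree, a multigraded map acts by the same scalar matrix. *)
Lemma compM r' r (m' : 'I_r' -> X) (m : 'I_r -> X) L c v :
  degree_compatible m' m L ->
  comp m c (v *m homogenize m' m L) = comp m' c v *m L.
Proof.
move=> compL; apply/rowP => b; rewrite !mxE raddf_sum /=.
transitivity (\sum_a if (m b <= c)%MM then
    (v 0 a * homogenize m' m L a b)@_(c - m b) else 0).
  by case: ifP => //; rewrite big1.
apply: eq_bigr => a _; rewrite !mxE.
have [->|/compL ba] := eqVneq (L a b) 0.
  by rewrite scale0r !mulr0 mcoeff0 if_same.
rewrite -scalerAr mcoeffZ mcoeffMX_sub.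
have [ac|] := boolP (m' a <= c)%MM.
  rewrite (lepm_trans ba ac) ifT; last first.
    apply/mnm_lepP => i; rewrite !mnmBE leq_sub2r //.
    exact: (mnm_lepP ac).
  rewrite mulrC; congr (_@_ _ * _); apply/mnmP => i; rewrite !mnmBE.
  by move/mnm_lepP/(_ i): ba; move/mnm_lepP/(_ i): ac; lia.
rewrite mul0r => ac; case: ifP => // bc; case: ifP; rewrite ?mulr0 // => H.
case/negP: ac; apply/mnm_lepP => i; move/mnm_lepP/(_ i): H; rewrite !mnmBE.
by move/mnm_lepP/(_ i): ba; move/mnm_lepP/(_ i): bc; lia.
Qed.

Lemma comp_eventually0 r (m : 'I_r -> X) v :
  exists N, forall c, (N <= mdeg c)%N -> comp m c v = 0.
Proof.
exists (\sum_a (mdeg (m a) + msize (v 0%R a)))%N => c Nc; apply/rowP => a.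
rewrite !mxE; case: ifP => // ac; apply/memN_msupp_eq0/msize_mdeg_ge.
move: Nc; rewrite (bigD1 a) //= -[in mdeg c](submK ac) mdegD; lia.
Qed.

Lemma comp_exists r (m : 'I_r -> X) (W : X -> 'rV[K]_r) N :
  (forall c, (W c <= strand K m c)%MS) ->
  (forall c, (N <= mdeg c)%N -> W c = 0) ->
  exists v, forall c, comp m c v = W c.
Proof.
move=> Wst W0.
exists (\row_a \sum_(u : 'X_{1..n < N}) W (u + m a)%MM 0 a *: 'X_[u]).
move=> c; apply/rowP => a; rewrite !mxE.
case: ifP => [ac|]; last first.
  have [->//|/(strandP _ _ _ (Wst c))->//] := eqVneq (W c 0 a) 0.
have [cN|Nc] := ltnP (mdeg (c - m a)%MM) N.
  by rewrite (mcoeff_mpoly (fun u => W (u + m a)%MM 0 a)) // submK.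
rewrite W0 ?mxE; last first.
  by apply: leq_trans Nc _; rewrite mdegB.
rewrite raddf_sum big1 // => u _; rewrite /= mcoeffZ mcoeffX.
case: eqP => [uE|]; last by rewrite mulr0.
by have := bmdeg u; rewrite uE ltnNge Nc.
Qed.

(** Preimages found in each multidegree assemble into a polynomial vector, since
    only finitely many components of v are nonzero. *)
Lemma mem_image_strandwise r' r (m' : 'I_r' -> X) (m : 'I_r -> X) L v :
  degree_compatible m' m L ->
  (exists w, v = w *m homogenize m' m L) <->
  (forall c, exists2 w, (w <= strand K m' c)%MS & comp m c v = w *m L).
Proof.
move=> compL; split=> [[w ->] c|/choice2].
  by exists (comp m' c w); [apply: comp_strand | apply: compM].
case=> W Wst WE; have [N vN] := comp_eventually0 m v.
have [||w wE] := @comp_exists _ m'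
    (fun c => if (N <= mdeg c)%N then 0 else W c) N.
- by move=> c; case: ifP => // _; apply: sub0mx.
- by move=> c ->.
exists w; apply: (@comp_inj _ m) => c; rewrite compM // wE.
by case: ifP => [/vN ->|_]; rewrite ?mul0mx.
Qed.

Definition monomial_ideal (A : pred X) : set S :=
  [set f | forall u, f@_u != 0 -> A u].

Lemma monomial_idealP (A : pred X) :
  (forall c c', (c <= c')%MM -> A c -> A c') -> is_ideal (monomial_ideal A).
Proof.
move=> A_up; split=> [u|a f g If Ig u]; first by rewrite mcoeff0 eqxx.
rewrite mcoeffD => afg0; have [gu|/Ig//] := eqVneq (g@_u) 0.
move: afg0; rewrite gu addr0 -mcoeff_msupp => /msuppM_le/allpairsP.
case=> -[u1 u2] /= [_]; rewrite mcoeff_msupp => /If Au2 ->.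
exact: A_up (lem_addl _ _) Au2.
Qed.

Lemma monomial_ideal_hpart A d f :
  monomial_ideal A f -> monomial_ideal A (hpart d f).
Proof.
move=> If u; rewrite mcoeff_mpart; case: ifP => [_|]; last by rewrite eqxx.
exact: If.
Qed.

Definition realize (C : multicomplex K n) : free_complex K n :=
  @FreeComplex K n (mrank C) (fun i a => (mdeg (mshift a))%:Z)
    (homogenize (@mshift _ _ C 0) (fun=> 0%MM) (maug C))
    (fun i => homogenize (@mshift _ _ C i.+1) (@mshift _ _ C i) (mdiff C i)).

Lemma maug_compatible (C : multicomplex K n) :
  degree_compatible (@mshift _ _ C 0) (fun=> 0%MM) (maug C).
Proof. by move=> a b _; apply/mnm_lepP => i; rewrite mnm0E. Qed.

Lemma comp_aug (C : multicomplex K n) c (v : 'rV[S]_(mrank C 0)) :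
  ((v *m aug (realize C)) 0 0)@_c =
  (comp (@mshift _ _ C 0) c v *m maug C) 0 0.
Proof.
rewrite -(compM _ _ (@maug_compatible C)) [RHS]mxE.
rewrite ifT ?subm0 //=.
by apply/mnm_lepP => i; rewrite mnm0E.
Qed.

Lemma realize_resolution A C : multiresolution A C ->
  graded_resolution (monomial_ideal A) (realize C).
Proof.
move=> rC; have compC i : degree_compatible (@mshift _ _ C i.+1)
  (@mshift _ _ C i) (mdiff C i) by move=> a b; apply: (mres_diff rC).
split.
- move=> a b; have := mhomog_homogenize (@maug_compatible C) a b.
  rewrite mdeg0. by apply.
- by move=> i; apply: (mhomog_homogenize (compC i)).
- move=> f.
  have /choice2[W Wst WE] : forall c, exists2 w : 'rV_(mrank C 0),
      (w <= strand K (@mshift _ _ C 0) c)%MS &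
      ~~ A c -> w *m maug C = (f@_c)%:M.
    move=> c; have [Ac|/(mres_surj rC)[w wc w1]] := boolP (A c).
      by exists 0; rewrite ?sub0mx.
    exists (f@_c *: w); first exact: scalemx_sub.
    by move=> _; rewrite -scalemxAl w1 scalemx1.
  have [||v vE] := @comp_exists _ (@mshift _ _ C 0)
      (fun c => if (msize f <= mdeg c)%N then 0 else W c) (msize f).
  + by move=> c; case: ifP => // _; apply: sub0mx.
  + by move=> c ->.
  exists v => u; apply: contraR => Au.
  rewrite mcoeffB comp_aug vE; case: ifP => [fu|_].
    by rewrite mul0mx mxE subr0; apply/eqP/memN_msupp_eq0/msize_mdeg_ge.
  by rewrite WE // mxE eqxx mulr1n subrr.
- case=> [|i] v.
  + rewrite (mem_image_strandwise _ (compC 0)); split=> [Iv c|H u].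
      apply/(mres_exact_aug rC); first exact: comp_strand.
      move=> Ac; apply/matrixP => x y; rewrite !ord1 -comp_aug [RHS]mxE.
      by apply/eqP; apply: contraNT Ac; apply: (Iv c).
    have /(mres_exact_aug rC (comp_strand _ _ _)) vu := H u.
    by apply: contraNT => /vu; rewrite comp_aug => ->; rewrite mxE eqxx.
  + rewrite (mem_image_strandwise _ (compC i.+1)); split=> [/= v0 c|H /=].
      apply/(mres_exact rC); first exact: comp_strand.
      by rewrite -(compM _ _ (compC i)) v0 raddf0.
    apply: (@comp_inj _ (@mshift _ _ C i)) => c.
    by rewrite raddf0 compM //; apply/(mres_exact rC); [apply: comp_strand|].
Qed.

Lemma realize_minimal A C : multiresolution A C -> multiminimal C ->
  minimal_free_resolution (monomial_ideal A) (realize C).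
Proof.
move=> rC mC; have rR := realize_resolution rC; split.
- by move=> a; move: (gr_aug rR a 0); rewrite subr0.
- exact: gr_diff rR.
- exact: gr_surj rR.
- exact: (@gr_exact _ _ _ _ rR 0).
- by move=> i; apply: (@gr_exact _ _ _ _ rR i.+1).
move=> i a b; rewrite mxE mcoeffZ mcoeffX.
have [->|L0] := eqVneq (mdiff C i a b) 0; first by rewrite mul0r.
case: eqP => [ab|]; last by rewrite mulr0.
have ba := mres_diff rC L0; have := submK ba; rewrite ab add0m => E.
by rewrite mC // eqxx in L0.
Qed.

(** * Relabelling *)

Definition relabel (psi : X -> X) (C : multicomplex K n) : multicomplex K n :=
  @MultiComplex K n (mrank C) (fun i a => psi (mshift a)) (maug C) (mdiff C).

(** The strand of the relabelled complex in degree [c] is the strand of the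
    original one in degree [phi c]. *)
Lemma relabel_resolution (phi psi : X -> X) A C :
  (forall b c, (psi b <= c)%MM = (b <= phi c)%MM) ->
  multiresolution A C -> multiresolution (A \o phi) (relabel psi C).
Proof.
move=> adj rC.
have st i c : strand K (fun a => psi (@mshift _ _ C i a)) c =
    strand K (@mshift _ _ C i) (phi c) by apply: eq_strand => a; apply: adj.
split=> [i a b L0|c|c v|i c v] /=; rewrite ?st.
- rewrite adj; apply: lepm_trans (mres_diff rC L0) _.
  by rewrite -adj lepm_refl.
- exact: (mres_surj rC (c := phi c)).
- exact: (mres_exact_aug rC (c := phi c)).
- exact: (mres_exact rC (c := phi c)).
Qed.

End Realization.

(** * Symbolic powers of cover ideals *)

Section CoverIdeals.
Variables (K : fieldType) (n : nat).
Local Notation S := {mpoly K[n]}.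
Local Notation X := 'X_{1..n}.
Implicit Types (I : set S) (f s : S) (u m : X) (i j : 'I_n).

Lemma ideal_mnm I u m : is_ideal I -> I 'X_[u] -> (u <= m)%MM -> I 'X_[m].
Proof. by move=> II Iu um; rewrite -(submK um) mpolyXD; apply: idealM. Qed.

Lemma ideal_monomials I f :
  is_ideal I -> (forall m, f@_m != 0 -> I 'X_[m]) -> I f.
Proof.
move=> II H; rewrite [f]mpolyE big_seq; elim/big_ind: _ => [|g h|m].
- exact: II.1.
- exact: idealD.
by rewrite mcoeff_msupp -mul_mpolyC => /H; apply: idealM.
Qed.

(** The k-th power of (x_i, x_j), for distinct i and j. *)
Definition pair_ideal i j k : set S :=
  monomial_ideal (fun u => k <= u i + u j)%N.

Lemma pair_idealP i j k : is_ideal (pair_ideal i j k).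
Proof.
apply: monomial_idealP => c c' /mnm_lepP cc' /leq_trans; apply.
by rewrite leq_add.
Qed.

Lemma pair_ideal_sym i j k : pair_ideal i j k = pair_ideal j i k.
Proof. by rewrite /pair_ideal; under eq_fun do rewrite addnC. Qed.

Lemma mnm_le1 i u : (0 < u i)%N -> (U_(i) <= u)%MM.
Proof. by rewrite lep1mP lt0n. Qed.

Lemma pair_ideal_gen i j :
  ideal_gen [set 'X_i; 'X_j] = pair_ideal i j 1 :> set S.
Proof.
apply/seteqP; split.
  apply: smallest_sub; first exact: pair_idealP.
  by move=> f [] -> u; rewrite mcoeffX; case: (_ =P u) => [<-|];
    rewrite ?eqxx // !mnm1E eqxx ?addnS.
move=> f If; have II := ideal_gen_ideal [set 'X_i; 'X_j : S].
apply: (ideal_monomials II) => m /If.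
have [mi _|] := ltnP 0 (m i).
  by apply: (ideal_mnm II) (mnm_le1 mi) => J [_]; apply; left.
rewrite leqn0 => /eqP-> mj.
by apply: (ideal_mnm II) (mnm_le1 mj) => J [_]; apply; right.
Qed.

Lemma pair_idealM i j k l f g : pair_ideal i j k f -> pair_ideal i j l g ->
  pair_ideal i j (k + l) (f * g).
Proof.
move=> If Ig u; rewrite -mcoeff_msupp => /msuppM_le/allpairsP[[u1 u2] /=].
rewrite !mcoeff_msupp => -[/If h1 /Ig h2 ->].
by rewrite !mnmDE addnACA leq_add.
Qed.

Lemma pair_ideal_le i j k l f : (l <= k)%N ->
  pair_ideal i j k f -> pair_ideal i j l f.
Proof. by move=> lk If u /If; apply: leq_trans. Qed.

Lemma pair_ideal_pow I i j k : I `<=` pair_ideal i j 1 ->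
  ideal_pow I k `<=` pair_ideal i j k.
Proof.
move=> IP; apply: smallest_sub; first exact: pair_idealP.
move=> _ [f /= If <-]; elim: k f If => [|k IH] f If; first by [].
rewrite big_ord_recr /=.
have := @pair_idealM i j k 1 _ _ _ (IP _ (If ord_max)); rewrite addn1; apply.
by apply: (IH (fun t => f (widen_ord (leqnSn k) t))) => t; apply: If.
Qed.

(** The order of vanishing along x_i = x_j = 0 is a valuation. If f has order
    exactly k and s has order 0, the product of their initial forms is a nonzero
    form of order k, the initial form of s f. *)
Lemma pair_ideal_cancel i j k s f :
  ~ pair_ideal i j 1 s -> pair_ideal i j k (s * f) -> pair_ideal i j k f.
Proof.
move=> Ns; elim: k => [|k IH] // Isf.
have If : pair_ideal i j k f by apply: IH; apply: pair_ideal_le Isf.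
pose s0 := mpart (fun u => u i + u j == 0)%N s.
pose fk := mpart (fun u => u i + u j == k)%N f.
have Is : pair_ideal i j 1 (s - s0).
  move=> u; rewrite mcoeffB mcoeff_mpart lt0n.
  by case: ifP => // _; rewrite subrr eqxx.
have Ifk : pair_ideal i j k.+1 (f - fk).
  move=> u; rewrite mcoeffB mcoeff_mpart.
  case: ifP => [_|/eqP]; first by rewrite subrr eqxx.
  by rewrite subr0 => + /If; lia.
have [fk0|fk0] := eqVneq fk 0; first by rewrite fk0 subr0 in Ifk.
have s00 : s0 != 0 by apply/eqP => s00; rewrite s00 subr0 in Is.
have I0k : pair_ideal i j k.+1 (s0 * fk).
  have -> : s0 * fk = s * f - ((s - s0) * f + s0 * (f - fk)).
    by rewrite mulrBl mulrBr addrA subrK opprB addrC subrK.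
  have II := pair_idealP i j k.+1.
  apply: (idealD II) => //; apply/(idealN II)/(idealD II); last first.
    exact: (idealM II).
  by rewrite -add1n; apply: pair_idealM.
have /mlead_supp lead0k : s0 * fk != 0 by rewrite mulf_neq0.
have := I0k (mlead (s0 * fk)); rewrite -mcoeff_msupp => /(_ lead0k).
case/msuppM_le/allpairsP: lead0k => -[u1 u2] /=.
rewrite !mcoeff_msupp !mcoeff_mpart => -[+ + ->]; rewrite !mnmDE.
case: ifP => [/eqP h1 _|_]; last by rewrite eqxx.
case: ifP => [/eqP h2 _|_]; last by rewrite eqxx.
lia.
Qed.

Lemma pair_ideal_prime i j : is_prime_ideal (pair_ideal i j 1).
Proof.
split; first exact: pair_idealP.
  by move/(_ 0%MM); rewrite mcoeff1 eqxx oner_eq0 !mnm0E => /(_ isT).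
move=> x y Ixy.
have [Ix|Nx] := boolp.pselect (pair_ideal i j 1 x); first by left.
by right; apply: pair_ideal_cancel Nx Ixy.
Qed.

Lemma prime_ideal_prod P (J : finType) (A : pred J) (F : J -> S) :
  is_prime_ideal P -> P (\prod_(t | A t) F t) -> exists2 t, A t & P (F t).
Proof.
case=> PI P1 PM; apply: boolp.contraPP => H.
elim/big_ind: _ => [//|x y Nx Ny /PM[]//|t At Pt].
by apply: H; exists t.
Qed.

Section Cover.
Variable e : rel 'I_n.
Hypothesis e_irr : irreflexive e.
Local Notation J := (cover_ideal K e).

Definition covers k u : bool :=
  [forall i, forall j, e i j ==> (k <= u i + u j)%N].

Lemma coversP k u :
  reflect (forall i j, e i j -> (k <= u i + u j)%N) (covers k u).
Proof.
apply: (iffP 'forall_forallP) => [H i j|H i j]; first exact/implyP/H.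
exact/implyP/H.
Qed.

Lemma mem_cover_ideal f :
  J f <-> forall i j, e i j -> pair_ideal i j 1 f.
Proof.
split=> [Jf i j eij|H [i j] /= eij]; last by rewrite pair_ideal_gen; apply: H.
by rewrite -pair_ideal_gen; apply: (Jf (i, j)).
Qed.

Lemma cover_ideal_mnm u : covers 1 u -> J 'X_[u].
Proof.
move/coversP=> cu; apply/mem_cover_ideal => i j eij v; rewrite mcoeffX.
by case: (_ =P v) => [<- _|]; [apply: cu | rewrite eqxx].
Qed.

(** Otherwise every edge has an endpoint whose variable is not in P; the product
    of all variables outside of P then lies in the cover ideal, but not in P. *)
Lemma prime_over_cover P : is_prime_ideal P -> J `<=` P ->
  exists i j, e i j /\ pair_ideal i j 1 `<=` P.
Proof.
move=> Pp JP; have [PI _ _] := Pp.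
pose A v := `[< ~ P 'X_v >].
have [[i [j [eij nAi nAj]]]|H] :=
    boolp.pselect (exists i j, [/\ e i j, ~~ A i & ~~ A j]).
  exists i, j; split=> //; rewrite -pair_ideal_gen; apply: smallest_sub => //.
  by move: nAi nAj => /boolp.asboolPn/boolp.contrapT Pi
    /boolp.asboolPn/boolp.contrapT Pj f [] ->.
have /JP : J (\prod_(v | A v) 'X_v).
  rewrite mprodXE; apply: cover_ideal_mnm; apply/coversP => i j eij.
  have AE v : A v -> (0 < (\sum_(v | A v) U_(v))%MM v)%N.
    by move=> Av; rewrite mnm_sumE (bigD1 v) //= mnm1E eqxx.
  have [/AE|nAi] := boolP (A i); first by lia.
  have [/AE|nAj] := boolP (A j); first by lia.
  by case: H; exists i, j.
by case/(prime_ideal_prod Pp) => v /boolp.asboolP.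
Qed.

Lemma pair_ideal_sub i j p q : p != q ->
  pair_ideal p q 1 `<=` pair_ideal i j 1 -> pair_ideal p q 1 = pair_ideal i j 1.
Proof.
move=> pq H.
have /H/(_ U_(p)%MM) : pair_ideal p q 1 'X_p.
  move=> u; rewrite mcoeffX; case: (_ =P u) => [<-|]; last by rewrite eqxx.
  by rewrite !mnm1E eqxx.
have /H/(_ U_(q)%MM) : pair_ideal p q 1 'X_q.
  move=> u; rewrite mcoeffX; case: (_ =P u) => [<-|]; last by rewrite eqxx.
  by rewrite !mnm1E eqxx addnS.
rewrite !mcoeffX !eqxx oner_neq0 !mnm1E => /(_ isT) hq /(_ isT) hp.
move: hp hq; case: (p =P i) => [<-|_]; case: (p =P j) => [<-|_] //= _.
- by case: (q =P p) pq => [->|]; rewrite ?eqxx.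
- by rewrite (eq_sym q p) (negPf pq) add0n; case: (q =P j) => // ->.
- by rewrite (eq_sym q p) (negPf pq) addn0; case: (q =P i) => // -> _;
    apply: pair_ideal_sym.
Qed.

Lemma edge_neq i j : e i j -> i != j.
Proof. by apply: contraTneq => ->; rewrite e_irr. Qed.

Lemma cover_minimal_primes P :
  minimal_primes J P <-> exists i j, e i j /\ P = pair_ideal i j 1.
Proof.
have JP i j : e i j -> J `<=` pair_ideal i j 1.
  by move=> eij f /mem_cover_ideal; apply.
split=> [[Pp /(prime_over_cover Pp)[i [j [eij ijP]]] Pmin]|[i [j [eij ->]]]].
  exists i, j; split=> //; apply/esym/Pmin => //; first exact: pair_ideal_prime.
  exact: JP.
split; [exact: pair_ideal_prime | exact: JP |].
move=> Q Qp /(prime_over_cover Qp)[p [q [epq pqQ]]] Qij.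
apply/seteqP; split=> //.
by rewrite -(pair_ideal_sub (edge_neq epq) (subset_trans pqQ Qij)).
Qed.

Lemma sum_ltn_ord k a : (\sum_(t < k) (t < a) = minn k a)%N.
Proof.
elim: k => [|k IH]; first by rewrite big_ord0 min0n.
by rewrite big_ord_recr /= IH; lia.
Qed.

(** With w the product of the variables other than x_i and x_j, both w x_i and
    w x_j lie in the cover ideal; so w^k carries (x_i, x_j)^k into its k-th
    power. *)
Lemma ideal_pow_mnm i j k u : e i j ->
  (forall v, v != i -> v != j -> (k <= u v)%N) -> (k <= u i + u j)%N ->
  ideal_pow J k 'X_[u].
Proof.
move=> eij uv uij; have ij := edge_neq eij.
pose w := [multinom ((v != i) && (v != j) : nat) | v < n].
have Jwi : J 'X_[w + U_(i)].
  apply: cover_ideal_mnm; apply/coversP => p q epq; have pq := edge_neq epq.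
  rewrite !mnmDE !mnmE.
  case: (p =P i); case: (p =P j); case: (q =P i); case: (q =P j);
    move=> *; subst; rewrite ?eqxx // in pq ij *; lia.
have Jwj : J 'X_[w + U_(j)].
  apply: cover_ideal_mnm; apply/coversP => p q epq; have pq := edge_neq epq.
  rewrite !mnmDE !mnmE.
  case: (p =P i); case: (p =P j); case: (q =P i); case: (q =P j);
    move=> *; subst; rewrite ?eqxx // in pq ij *; lia.
pose g (t : 'I_k) : X := (w + (if (t < u i)%N then U_(i) else U_(j)))%MM.
apply: (@ideal_mnm _ (\sum_t g t)%MM); first exact: ideal_gen_ideal.
  move=> I [_]; apply; exists (fun t => 'X_[g t]); last exact: mprodXE.
  by move=> t; rewrite /g; case: ifP.
apply/mnm_lepP => v; rewrite mnm_sumE.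
under eq_bigr do rewrite mnmDE mnmE (fun_if (fun m : X => m v)) !mnm1E.
have [->|vi] := eqVneq v i.
  rewrite (eq_bigr (fun t : 'I_k => (t < u i)%N : nat)) => [|t _].
    by rewrite sum_ltn_ord geq_minr.
  by rewrite (eq_sym j) (negPf ij); case: ifP.
have [->|vj] := eqVneq v j.
  rewrite (eq_bigr (fun t : 'I_k => 1 - (t < u i))%N) => [|t _].
    rewrite sumnB => [|t _]; last by case: (t < u i)%N.
    by rewrite sum_ltn_ord sum1_card card_ord; lia.
  by case: ifP.
rewrite (eq_bigr (fun=> 1%N)) => [|t _].
  by rewrite sum1_card card_ord; apply: uv.
by rewrite if_same.
Qed.

Lemma loc_kernel_cover i j k : e i j ->
  loc_kernel J k (pair_ideal i j 1) = pair_ideal i j k.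
Proof.
move=> eij; apply/seteqP; split=> f.
  case=> s Ns Jsf; apply: pair_ideal_cancel Ns _.
  by apply: pair_ideal_pow Jsf => g /mem_cover_ideal; apply.
move=> If.
pose w := [multinom (if (v == i) || (v == j) then 0 else k)%N | v < n].
have wi : w i = 0%N by rewrite mnmE eqxx.
have wj : w j = 0%N by rewrite mnmE eqxx orbT.
exists 'X_[w].
  by move/(_ w); rewrite mcoeffX eqxx oner_eq0 wi wj => /(_ isT).
apply: ideal_monomials; first exact: ideal_gen_ideal.
move=> u; rewrite mulrC mcoeffMX_sub; case: ifP; last by rewrite eqxx.
move=> /mnm_lepP wu /If; rewrite !mnmBE wi wj !subn0.
apply: ideal_pow_mnm => // v /negPf vi /negPf vj.
by have := wu v; rewrite mnmE vi vj.
Qed.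

Theorem symbolic_pow_cover k :
  symbolic_pow J k = monomial_ideal (covers k).
Proof.
apply/seteqP; split=> f.
  move=> Sf u fu; apply/coversP => i j eij.
  suff : pair_ideal i j k f by apply.
  rewrite -loc_kernel_cover //.
  by apply/Sf/cover_minimal_primes; exists i, j.
move=> If _ /cover_minimal_primes[i [j [eij ->]]]; rewrite loc_kernel_cover //.
by move=> u /If/coversP; apply.
Qed.

End Cover.
End CoverIdeals.

(** * Regularity *)

Lemma int_supremums_neq0 (B : set int) : B !=set0 ->
  supremums (EFin @` B) !=set0.
Proof.
move=> [b0 Bb0]; have [[M MB]|unbounded] :=
    boolp.pselect (exists M : int, forall b, B b -> b <= M); last first.
  exists +oo%E; split=> [x _|x Bx]; first exact: leey.
  case: x Bx => [M MB| |MB] //; last by have := MB _ (imageP _ Bb0).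
  by case: unbounded; exists M => b Bb; rewrite -lee_fin; apply/MB/imageP.
pose P d := `[< B (M - d%:Z) >].
have exP : exists d, P d.
  exists `|M - b0|%N; apply/boolp.asboolP.
  have := MB _ Bb0; rewrite -subr_ge0 => /gez0_abs ->.
  by rewrite subKr.
case: (ex_minnP exP) => d /boolp.asboolP Bd mind.
exists (M - d%:Z)%:E; split=> [_ [b Bb <-]|x]; last by apply; apply: imageP.
have Mb := MB _ Bb; rewrite lee_fin.
have : (d <= `|M - b|)%N.
  apply/mind/boolp.asboolP; have := Mb; rewrite -subr_ge0 => /gez0_abs ->.
  by rewrite subKr.
by lia.
Qed.

Lemma le_supremum_int (B B' : set int) :
  (forall b, B b -> exists2 b', B' b' & b <= b') ->
  (supremum -oo (EFin @` B) <= supremum -oo (EFin @` B'))%E.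
Proof.
move=> BB'; have [->|/set0P[b Bb]] := eqVneq B set0.
  by rewrite image_set0 supremum0 leNye.
have [b' B'b' _] := BB' _ Bb.
have ne (C : set int) c : C c ->
    supremums (EFin @` C) (supremum -oo%E (EFin @` C)).
  move=> Cc; rewrite /supremum ifF; last first.
    by apply/negbTE/set0P; exists c%:E; apply: imageP.
  by apply: xgetPex; apply: int_supremums_neq0; exists c.
have [_ lubB] := ne _ _ Bb; have [ubB' _] := ne _ _ B'b'.
apply: lubB => _ [x Bx <-]; have [x' B'x' xx'] := BB' _ Bx.
by apply: le_trans (ubB' _ (imageP _ B'x')); rewrite lee_fin.
Qed.

Section Regularity.
Variables (K : fieldType) (n : nat).
Local Notation S := {mpoly K[n]}.
Local Notation X := 'X_{1..n}.

Lemma reg_quotient_le (I I' : set S) :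
  (forall i j, betti I i j != 0%N ->
     exists2 j', betti I' i j' != 0%N & j <= j') ->
  (reg_quotient I <= reg_quotient I')%E.
Proof.
move=> H; have E (L : set S) : reg_quotient L = supremum -oo%E
    (EFin @` ((fun ij : nat * int => ij.2 - ij.1%:Z) @`
       [set ij | betti L ij.1 ij.2 != 0%N])).
  by rewrite /reg_quotient -image_comp.
rewrite !E; apply: le_supremum_int => _ [[i j] /= /H[j' b' jj'] <-].
exists (j' - i%:Z); last by rewrite lerD2r.
by exists (i, j').
Qed.

Lemma betti_neq0 (I : set S) i j : betti I i j != 0%N ->
  exists2 F, minimal_free_resolution I F &
    exists a : 'I_(rank F i), shift a = j.
Proof.
rewrite /betti; case: xgetP => [b _ [F mF ->]|]; last by rewrite eqxx.
by rewrite -lt0n => /card_gt0P[a /eqP aj]; exists F => //; exists a.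
Qed.

(** The Betti number may be read off another minimal resolution, but that one has
    the same shifts. *)
Lemma shift_betti (I : set S) F i (a : 'I_(rank F i)) :
  is_ideal I -> (forall d f, I f -> I (hpart d f)) ->
  minimal_free_resolution I F -> betti I i (shift a) != 0%N.
Proof.
move=> II Ih mF; rewrite /betti; case: xgetP => [b _ [G mG ->]|]; last first.
  by move=> /(_ _ (ex_intro2 _ _ F mF erefl)).
have [b' ba] := shift_occurs II Ih a mF (minimal_graded mG).
by rewrite -lt0n; apply/card_gt0P; exists b'; apply/eqP.
Qed.

(** The relabelled minimal resolution for A resolves the ideal of A o phi. Its
    shifts include those of a minimal resolution of that ideal, and are at most
    the shifts before relabelling. *)
Theorem reg_monomial_relabel (A : pred X) D (phi psi : X -> X) :
  (forall c c', (c <= c')%MM -> A c -> A c') ->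
  (forall c, A c -> A (trunc D c)) -> ~~ A 0%MM ->
  (forall b c, (psi b <= c)%MM = (b <= phi c)%MM) ->
  (forall b, (mdeg (psi b) <= mdeg b)%N) ->
  (reg_quotient (@monomial_ideal K n (A \o phi)) <=
   reg_quotient (@monomial_ideal K n A))%E.
Proof.
move=> A_up A_trunc A0 adj psi_le; apply: reg_quotient_le => i j.
case/betti_neq0 => F mF [a aj].
set M := min_complex K A_up A_trunc.
have rM : multiresolution A M := min_complex_resolution K A_up A_trunc.
have mM : multiminimal M by apply: min_complex_minimal.
have Ap_up c c' : (c <= c')%MM -> (A \o phi) c -> (A \o phi) c'.
  move=> cc'; apply: (A_up (phi c)); rewrite -adj; apply: lepm_trans cc'.
  by rewrite adj lepm_refl.
have [b ba] := shift_occurs (monomial_idealP K Ap_up)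
  (@monomial_ideal_hpart _ _ _) a mF
  (realize_resolution (relabel_resolution adj rM)).
exists (mdeg (mshift (b : 'I_(mrank M i))))%:Z; last first.
  by rewrite -aj -ba lez_nat; apply: psi_le.
exact: (@shift_betti _ (realize M) i b (monomial_idealP K A_up)
  (@monomial_ideal_hpart _ _ _) (realize_minimal rM mM)).
Qed.

Definition insert_level t (c : X) : X :=
  [multinom (c i + (t <= c i))%N | i < n].
Definition remove_level t (b : X) : X :=
  [multinom (b i - (t < b i))%N | i < n].

Lemma remove_insert_level t b c :
  (remove_level t b <= c)%MM = (b <= insert_level t c)%MM.
Proof.
apply/mnm_lepP/mnm_lepP => H i; move: (H i); rewrite !mnmE.
  by case: ltnP; case: leqP => /=; lia.
by case: ltnP; case: leqP => /=; lia.
Qed.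

Lemma mdeg_remove_level t b : (mdeg (remove_level t b) <= mdeg b)%N.
Proof. by rewrite !mdegE leq_sum // => i _; rewrite mnmE leq_subr. Qed.

Variable e : rel 'I_n.

(** With t = ceil(k / 2): two exponents below t have sum less than k, and still
    less than k + 1 when left alone; two exponents from t on have sum at least k,
    and at least k + 1 when raised; in the mixed case the sum is raised by
    exactly one. *)
Lemma covers_insert_level k :
  covers e k.+1 \o insert_level (uphalf k) = covers e k.
Proof.
apply/funext => c /=; apply/coversP/coversP => H i j /H; rewrite !mnmE;
  rewrite uphalf_half; have := odd_double_half k; rewrite -muln2;
  case: leqP; case: leqP; case: (odd k) => /=; lia.
Qed.

Lemma covers_up k c c' : (c <= c')%MM -> covers e k c -> covers e k c'.
Proof.
move=> /mnm_lepP cc' /coversP H; apply/coversP => i j /H.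
by move=> /leq_trans; apply; rewrite leq_add.
Qed.

Lemma covers_trunc k c : covers e k c -> covers e k (trunc k c).
Proof.
by move=> /coversP H; apply/coversP => i j /H; rewrite !mnmE; lia.
Qed.

Lemma covers_0 k i j : e i j -> ~~ covers e k.+1 0%MM.
Proof. by move=> eij; apply/negP => /coversP/(_ _ _ eij); rewrite !mnm0E. Qed.

Lemma covers_noedge k : (forall i j, ~~ e i j) -> covers e k = xpredT.
Proof.
by move=> ne; apply/funext => c; apply/coversP => i j; rewrite (negPf (ne i j)).
Qed.

End Regularity.

Theorem theorem4p1 (K : fieldType) (n : nat) (e : rel 'I_n)
    (e_sym : ssrbool.symmetric e) (e_irr : irreflexive e) (k : nat) (k_ge1 : (1 <= k)%N) :
  (reg_quotient (symbolic_pow (cover_ideal K e) k) <=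
   reg_quotient (symbolic_pow (cover_ideal K e) k.+1))%E.
Proof.
rewrite !symbolic_pow_cover //.
have [/existsP[i /existsP[j eij]]|] := boolP [exists i, exists j, e i j].
  rewrite -(covers_insert_level e k).
  apply: reg_monomial_relabel.
  - exact: covers_up.
  - exact: covers_trunc.
  - exact: covers_0 eij.
  - exact: remove_insert_level.
  - exact: mdeg_remove_level.
rewrite negb_exists => /forallP ne.
have no_edge i j : ~~ e i j.
  by move: (ne i); rewrite negb_exists => /forallP.
(* Without edges, both symbolic powers are the whole ring. *)
by rewrite !covers_noedge.
Qed.
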